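(* Let $M$ be a metric group and let $G$ be its isometry group. Then the following are equivalent: (a) $M^L\vartriangleleft G$, i.e. $F\circ M^L\circ F^{-1}=M^L$ for all $F\in G$; (b) $G$ is a subgroup of $\mathrm{Aff}(M)$; (c) $\mathrm{Stab}_1(G)$ is a subgroup of $\mathrm{Aut}(M)$; (d) $G=M^L\rtimes \mathrm{Stab}_1(G)$.
   Context: A metric group is a group $M$ equipped with a left-invariant distance $d$, i.e. $d(ap,aq)=d(p,q)$ for all $a,p,q\in M$ (no Lie or topological assumption is made). Its isometry group $G$ is the group, under composition, of all distance-preserving bijections of $M$. $M^L=\{L_m:m\in M\}\subseteq G$ is the group of left translations $L_m(p)=mp$. $\mathrm{Stab}_1(G)$ is the subgroup of those $F\in G$ fixing the identity element $1$ of $M$. $\mathrm{Aut}(M)$ is the group of (abstract) group automorphisms of $M$. A map between groups is affine if it is the composition of a left translation and a group homomorphism, and $\mathrm{Aff}(M)$ is the group of (bijective) affine maps from $M$ to $M$. The equality in (d) means that $G$ is the internal semi-direct product with normal factor $M^L$: $M^L$ is normal in $G$, $M^L\cap \mathrm{Stab}_1(G)=\{\mathrm{id}\}$ and $M^L\cdot\mathrm{Stab}_1(G)=G$. *)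

(* Defs.v *)
From HB Require Import structures.
From mathcomp Require Import all_boot all_order all_algebra.
From mathcomp Require Import boolp classical_sets reals topology.

Set Implicit Arguments.
Unset Strict Implicit.
Unset Printing Implicit Defensive.

Local Open Scope classical_set_scope.
Local Open Scope group_scope.

(* A metricType carries no more than a distance: its topology is the one
   generated by the balls. *)
HB.mixin Record isLeftInvariantMetric (R : realType) M
    of Metric R M & Group M := {
  mdist_mull : forall a p q : M, @mdist R M (a * p) (a * q) = mdist p q
}.

#[short(type="metricGroupType")]
HB.structure Definition MetricGroup (R : realType) :=
  {M of Metric R M & Group M & isLeftInvariantMetric R M}.

Record selfbij (T : Type) := SelfBij {
  selfbij_fun :> T -> T;
  selfbij_bij : bijective selfbij_fun
}.

Lemma selfbij_ext (T : Type) (F H : selfbij T) : F =1 H -> F = H.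
Proof.
case: F H => [f fP] [h hP] /= /funext fh; subst h.
by congr SelfBij; exact: Prop_irrelevance.
Qed.

Section SelfBijGroup.
Variable T : Type.
Implicit Types F H : selfbij T.

HB.instance Definition _ := gen_eqMixin (selfbij T).
HB.instance Definition _ := gen_choiceMixin (selfbij T).

Definition selfbij_one : selfbij T := SelfBij (Bijective (frefl id) (frefl id)).

Definition selfbij_mul F H : selfbij T :=
  SelfBij (bij_comp (selfbij_bij F) (selfbij_bij H)).

Lemma selfbij_inv_subproof F : {H : selfbij T | cancel H F & cancel F H}.
Proof.
suff /cid2[H] : exists2 H : selfbij T, cancel H F & cancel F H by exists H.
by case: F => f [g fK gK] /=; exists (SelfBij (Bijective gK fK)).
Qed.

Definition selfbij_inv F : selfbij T := s2val (selfbij_inv_subproof F).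

Lemma selfbij_mulA : associative selfbij_mul.
Proof. by move=> F H K; exact: selfbij_ext. Qed.

Lemma selfbij_mul1 : left_id selfbij_one selfbij_mul.
Proof. by move=> F; exact: selfbij_ext. Qed.

Lemma selfbij_mul1r : right_id selfbij_one selfbij_mul.
Proof. by move=> F; exact: selfbij_ext. Qed.

Lemma selfbij_mulV : left_inverse selfbij_one selfbij_inv selfbij_mul.
Proof.
move=> F; apply: selfbij_ext => x /=.
exact: (s2valP' (selfbij_inv_subproof F)).
Qed.

Lemma selfbij_mulVr : right_inverse selfbij_one selfbij_inv selfbij_mul.
Proof.
move=> F; apply: selfbij_ext => x /=.
exact: (s2valP (selfbij_inv_subproof F)).
Qed.

(* The group law is composition: (F * H) x = F (H x). *)
HB.instance Definition _ := isGroup.Build (selfbij T)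
  selfbij_mulA selfbij_mul1 selfbij_mul1r selfbij_mulV selfbij_mulVr.

End SelfBijGroup.

Section Subgroups.
Variable gT : groupType.
Implicit Types H K N : set gT.

Definition is_subgroup H K :=
  [/\ group_closed (mem H), group_closed (mem K) & H `<=` K].

Definition is_normal N H :=
  is_subgroup N H /\ forall x, H x -> [set x * y * x^-1 | y in N] = N.

Definition is_sdprod N K H :=
  [/\ is_normal N H, is_subgroup K H, N `&` K = [set 1]
    & [set x * y | x in N & y in K] = H].

End Subgroups.

Section Groups.
Variable M : groupType.

Definition left_translation (m : M) : selfbij M :=
  SelfBij (Bijective (mulKg m) (mulVKg m)).

Definition left_translations : set (selfbij M) := range left_translation.

Definition Aut : set (selfbij M) := [set F | {morph F : p q / p * q}].

Definition Aff : set (selfbij M) :=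
  [set F | exists (m : M) (h : M -> M),
     {morph h : p q / p * q} /\ F = left_translation m \o h :> (M -> M)].

End Groups.

Arguments left_translations : clear implicits.
Arguments Aut : clear implicits.
Arguments Aff : clear implicits.

Section MetricGroups.
Variables (R : realType) (M : metricGroupType R).

Definition isometry_group : set (selfbij M) :=
  [set F | forall p q : M, @mdist R M (F p) (F q) = mdist p q].

Definition isometry_stab1 : set (selfbij M) :=
  [set F | isometry_group F /\ F 1 = 1].

End MetricGroups.

Arguments isometry_group {R} M.
Arguments isometry_stab1 {R} M.

(* Main.v *)
Require Import Defs.
From mathcomp Require Import all_boot all_order all_algebra.
From mathcomp Require Import boolp classical_sets reals topology.

(** Every isometry is [L_m * K] with [K] an isometry fixing [1], because left
    translations are isometries. For such a [K] the left translations are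
    normalised by [K] exactly when [K] is a morphism: if
    [K * L_a * K^-1 = L_b], evaluating at [1] gives [b = K a], so the equation
    reads [K (a * p) = K a * K p]; conversely [K * L_a * K^-1 = L_(K a)] for a
    morphism [K]. An affine map fixing [1] is a morphism. *)

Local Open Scope classical_set_scope.
Local Open Scope group_scope.

Section SelfBijections.
Variable T : Type.
Implicit Type F : selfbij T.

Lemma selfbijK F : cancel F F^-1.
Proof.
by move=> x; have /(congr1 (@^~ x)) := congr1 (@selfbij_fun T) (mulVg F).
Qed.

Lemma selfbijVK F : cancel F^-1 F.
Proof.
by move=> x; have /(congr1 (@^~ x)) := congr1 (@selfbij_fun T) (mulgV F).
Qed.

End SelfBijections.

(** [group_closed] asks for closure under division; this splits it into products and inverses. *)
Lemma group_closed_set (gT : groupType) (H : set gT) :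
  H 1 -> (forall x y, H x -> H y -> H (x * y)) ->
  (forall x, H x -> H x^-1) -> group_closed (mem H).
Proof.
move=> H1 HM HV; split=> [|x y /set_mem Hx /set_mem Hy]; apply: mem_set => //.
by apply: HM => //; exact: HV.
Qed.

Section GroupSelfBijections.
Variable M : groupType.
Implicit Types (m p : M) (F : selfbij M).

Lemma left_translation1 : left_translation (1 : M) = 1.
Proof. by apply: selfbij_ext => p; exact: mul1g. Qed.

Lemma left_translationM m p :
  left_translation (m * p) = left_translation m * left_translation p.
Proof. by apply: selfbij_ext => q; rewrite /= mulgA. Qed.

Lemma left_translationV m : left_translation m^-1 = (left_translation m)^-1.
Proof.
by apply/esym/mulg1_eq; rewrite -left_translationM mulgV left_translation1.
Qed.

Lemma left_translations_group_closed : group_closed (mem (left_translations M)).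
Proof.
apply: group_closed_set.
- by exists 1; rewrite ?left_translation1.
- by move=> _ _ [m _ <-] [p _ <-]; exists (m * p); rewrite ?left_translationM.
- by move=> _ [m _ <-]; exists m^-1; rewrite ?left_translationV.
Qed.

Lemma Aut_group_closed : group_closed (mem (Aut M)).
Proof.
apply: group_closed_set => // [F H FM HM p q|F FM p q].
  by rewrite /= HM FM.
by apply: (can_inj (selfbijK _ F)); rewrite FM !selfbijVK.
Qed.

(* Affine maps are the maps preserving the ternary operation [x / y * z], a
   condition visibly stable under composition and inversion. *)
Lemma AffP F : Aff M F <-> forall x y z, F (x / y * z) = F x / F y * F z.
Proof.
split=> [[m [h [hM ->]]] x y z /=|FA].
  (* [h] is only known to be multiplicative, so its values at units and inverses come from
     cancellation. *)
  have h1 : h 1 = 1 by apply: (@mulgI _ (h 1)); rewrite -hM !mulg1.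
  have hV : h y^-1 = (h y)^-1.
    by apply/esym/mulg1_eq; rewrite -hM mulgV h1.
  (* The [m^-1] coming from [(m * h y)^-1] cancels the [m] in front of [h z]. *)
  by rewrite !hM hV invgM !mulgA mulgVK.
(* A homomorphism fixes [1], so the translation part must be [F 1]. Multiplicativity is the ternary
   identity at [y = 1], with [p * q] read as [p / 1 * q]. *)
exists (F 1), (fun p => (F 1)^-1 * F p); split=> [p q|].
  by rewrite -[p in LHS]mulg1 -[in p * 1]invg1 FA !mulgA.
by apply/funext => p; rewrite /= mulVKg.
Qed.

Lemma Aff_group_closed : group_closed (mem (Aff M)).
Proof.
apply: group_closed_set => [|F H /AffP FA /AffP HA|F /AffP FA]; apply/AffP.
- by [].
- by move=> x y z; rewrite /= HA FA.
- by move=> x y z; apply: (can_inj (selfbijK _ F)); rewrite FA !selfbijVK.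
Qed.

(** Put [y = 1] in the ternary identity: the middle factor [F 1] disappears. *)
Lemma Aff_fix1 F : Aff M F -> F 1 = 1 -> Aut M F.
Proof.
by move=> /AffP FA F1 p q; have := FA p 1 q; rewrite F1 !invg1 !mulg1.
Qed.

Lemma conj_left_translation F m :
  Aut M F -> F * left_translation m * F^-1 = left_translation (F m).
Proof. by move=> FM; apply: selfbij_ext => p; rewrite /= FM selfbijVK. Qed.

Lemma conj_left_translation_Aut F : F 1 = 1 ->
  (forall m, left_translations M (F * left_translation m * F^-1)) -> Aut M F.
Proof.
move=> F1 FL m p; have [b _ bE] := FL m.
(* Evaluating the conjugate at [F q] cancels its inner [F^-1]; the case [q = 1] then identifies
   [b]. *)
have FE q : F (m * q) = b * F q.
  have := congr1 (fun K : selfbij M => K (F q)) bE.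
  by rewrite /= selfbijK => ->.
by have := FE 1; rewrite mulg1 F1 mulg1 => ->; exact: FE.
Qed.

End GroupSelfBijections.

Section MetricGroupIsometries.
Variables (R : realType) (M : metricGroupType R).
Implicit Types (m : M) (F : selfbij M).

Lemma left_translation_isometry m : isometry_group M (left_translation m).
Proof. exact: mdist_mull. Qed.

Lemma isometryM F H :
  isometry_group M F -> isometry_group M H -> isometry_group M (F * H).
Proof. by move=> FG HG p q; rewrite /= FG HG. Qed.

Lemma isometryV F : isometry_group M F -> isometry_group M F^-1.
Proof. by move=> FG p q; rewrite -FG !selfbijVK. Qed.

Lemma isometry_group_closed : group_closed (mem (isometry_group M)).
Proof. by apply: group_closed_set => //; [exact: isometryM|exact: isometryV]. Qed.

Lemma isometry_stab1_closed : group_closed (mem (isometry_stab1 M)).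
Proof.
apply: group_closed_set => // [F H [FG F1] [HG H1]|F [FG F1]].
  by split; [exact: isometryM|rewrite /= H1 F1].
by split; [exact: isometryV|rewrite -[in LHS]F1 selfbijK].
Qed.

Lemma left_translations_subgroup :
  is_subgroup (left_translations M) (isometry_group M).
Proof.
split; [exact: left_translations_group_closed|exact: isometry_group_closed|].
by move=> _ [m _ <-]; exact: left_translation_isometry.
Qed.

Lemma isometry_decomp F : isometry_group M F ->
  exists m K, isometry_stab1 M K /\ F = left_translation m * K.
Proof.
(* Translating back by [F 1] brings the image of [1] to [1]. *)
move=> FG; exists (F 1), ((left_translation (F 1))^-1 * F); split.
  rewrite -left_translationV; split; last exact: mulVg.
  by apply: isometryM => //; exact: left_translation_isometry.
by rewrite mulVKg.
Qed.

Lemma normal_left_translations :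
  isometry_stab1 M `<=` Aut M ->
  is_normal (left_translations M) (isometry_group M).
Proof.
move=> stabA; split; first exact: left_translations_subgroup.
(* One inclusion for every isometry suffices: applied to [F^-1], it yields the reverse inclusion for
   [F]. *)
have conjL F m : isometry_group M F ->
    left_translations M (F * left_translation m * F^-1).
  move=> /isometry_decomp[a [K [/stabA KA ->]]].
  (* Conjugation by [K] turns [L_m] into [L_(K m)], and conjugation by [L_a] then conjugates the
     index by [a]. *)
  exists (a * K m * a^-1) => //.
  by rewrite !left_translationM left_translationV -conj_left_translation //
    invgM !mulgA.
move=> F FG; apply/seteqP; split=> [_ [_ [m _ <-] <-]|_ [m _ <-]].
  exact: conjL.
exists (F^-1 * left_translation m * F); last by rewrite !mulgA mulgK mulgV mul1g.
by have := conjL _ m (isometryV _ FG); rewrite invgK.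
Qed.

End MetricGroupIsometries.

Theorem lemma3p2 (R : realType) (M : metricGroupType R) :
  [<-> is_normal (left_translations M) (isometry_group M);
       is_subgroup (isometry_group M) (Aff M);
       is_subgroup (isometry_stab1 M) (Aut M);
       is_sdprod (left_translations M) (isometry_stab1 M) (isometry_group M)].
Proof.
tfae.
- move=> [_ nL]; split; [exact: isometry_group_closed|exact: Aff_group_closed|].
  move=> F /isometry_decomp[m [K [[KG K1] ->]]].
  (* Normality is applied to [K], itself an isometry, so [K] is a morphism and can serve as the
     homomorphism part. *)
  exists m, K; split=> //; apply: conj_left_translation_Aut => // p.
  by rewrite -(nL K KG); exists (left_translation p) => //; exists p.
- move=> [_ _ GA]; split; [exact: isometry_stab1_closed|exact: Aut_group_closed|].
  by move=> F [/GA FA F1]; exact: Aff_fix1.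
- move=> [_ _ stabA]; split.
  + exact: normal_left_translations.
  + split; [exact: isometry_stab1_closed|exact: isometry_group_closed|].
    by move=> F [].
  (* A left translation is determined by its value at [1], so one that fixes [1] is the identity. *)
  + apply/seteqP; split=> [_ [[m _ <-] [_ /=]]|_ ->].
      by rewrite mulg1 => ->; exact: left_translation1.
    by split=> //; exists 1; rewrite ?left_translation1.
  + apply/seteqP; split=> [_ [_ [m _ <-] [K [KG _] <-]]|F].
      by apply: isometryM => //; exact: left_translation_isometry.
    move=> /isometry_decomp[m [K [KS ->]]].
    by exists (left_translation m); [exists m|exists K].
- by case.
Qed.
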